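(* For every integer $n\ge 0$, $$\Delta b_{2,2}(2n+1)=\Delta b_{2,2}(2n)=b_{1,2}(n+1).$$
   Context: A partition $\lambda=(\lambda_1,\dots,\lambda_\ell)$ of $n$ is a weakly decreasing sequence of positive integers with sum $n$, identified with its multiset of parts; $\ell(\lambda)=\ell$ is its length; the empty partition is the only partition of $0$. A binary partition is a partition all of whose parts are powers of $2$ (including $2^0=1$), and $\mathcal B(n)$ is the set of binary partitions of $n$. For a partition $\lambda$ with $\ell(\lambda)\ge2$, $\mathrm{pre}_2(\lambda)$ is the partition whose multiset of parts is $\{\lambda_i\lambda_k\mid 1\le i<k\le\ell(\lambda)\}$ (with multiplicity, one part for each pair $i<k$); if $\ell(\lambda)<2$, $\mathrm{pre}_2(\lambda)=\emptyset$. $\mathrm{pre}_2(\mathcal B(n))$ is the set of partitions $\mathrm{pre}_2(\lambda)$ with $\lambda\in\mathcal B(n)$. For $i\in\{1,2\}$, $b_{i,2}(n)$ is the total number of parts equal to $i$ (counted with multiplicity) in all partitions in $\mathrm{pre}_2(\mathcal B(n))$; in particular $b_{2,2}(0)=0$. For $n\ge0$, $\Delta b_{2,2}(n)=b_{2,2}(n+1)-b_{2,2}(n)$. *)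

(* Defs.v *)
From mathcomp Require Import all_boot all_order all_algebra.
From mathcomp Require Import boolp classical_sets functions cardinality fsbigop.

Set Implicit Arguments.
Unset Strict Implicit.
Unset Printing Implicit Defensive.

Import GRing.Theory.

Local Open Scope classical_set_scope.
Local Open Scope ring_scope.

Definition partitions (n : nat) : set (seq nat) :=
  [set s | [/\ sorted geq s, (forall x, x \in s -> (0 < x)%N) & sumn s = n]].

Definition binary_partitions (n : nat) : set (seq nat) :=
  [set s | partitions n s /\
           forall x, x \in s -> exists k : nat, x = (2 ^ k)%N].

(* The inner index i ranges over 0, ..., k - 1, so each pair i < k < size s
   contributes one part; in particular pre2 s is empty when size s < 2. *)
Definition pre2 (s : seq nat) : seq nat :=
  sort geq [seq (nth 0%N s i * nth 0%N s k)%N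
           | k <- iota 0 (size s), i <- iota 0 k].

(* The sum ranges over the image as a set, so a partition that is pre2 of
   several binary partitions is counted once. Sums over infinite supports are 0
   by convention; finite_pre2_binary_partitions below excludes that case. *)
Definition b2 (i n : nat) : nat :=
  \sum_(mu \in pre2 @` binary_partitions n) count_mem i mu.

Definition Delta (f : nat -> nat) (n : nat) : int :=
  (f n.+1)%:Z - (f n)%:Z.

Lemma finite_partitions (n : nat) : finite_set (partitions n).
Proof.
pose T := {bseq n of 'I_n.+1}.
pose f (u : T) : seq nat := [seq val x | x <- u].
apply: (@sub_finite_set _ _ (range f)); last first.
  by apply: finite_image; exact: finite_finset.
move=> s [_ s_gt0 sum_s].
have size_le : (size s <= n)%N.
  rewrite -sum_s; elim: s s_gt0 {sum_s} => //= x s IHs s_gt0.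
  rewrite -add1n leq_add ?s_gt0 ?mem_head //.
  by apply: IHs => y ys; rewrite s_gt0 // inE ys orbT.
have part_le x : x \in s -> (x < n.+1)%N.
  rewrite ltnS -sum_s => xs.
  by rewrite (perm_sumn (perm_to_rem xs)) /= leq_addr.
have size_le' : (size [seq inord x : 'I_n.+1 | x <- s] <= n)%N.
  by rewrite size_map.
exists (Bseq size_le') => //; rewrite /f /= -map_comp.
by rewrite -[RHS]map_id; apply/eq_in_map => x /part_le lt_xn /=; rewrite inordK.
Qed.

Lemma finite_pre2_binary_partitions (n : nat) :
  finite_set (pre2 @` binary_partitions n).
Proof.
apply: finite_image; apply: sub_finite_set (finite_partitions n).
by move=> s [].
Qed.

(* Main.v *)
Require Import Defs.
From mathcomp Require Import all_boot all_order all_algebra.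
From mathcomp Require Import boolp classical_sets functions cardinality fsbigop.
From mathcomp Require Import zify.

Set Implicit Arguments.
Unset Strict Implicit.
Unset Printing Implicit Defensive.

(** Write p_j for the sum of the j-th powers of the parts. Since
    p_j(s)^2 = 2 p_j(pre2 s) + p_{2j}(s), for a partition s of n the data n
    and pre2 s determine p_1(s), p_2(s), p_4(s), p_8(s), ..., and these
    determine s (compare largest parts). Hence pre2 is injective on partitions of n, and
    with m_i the multiplicity of i, b_{1,2}(n) and b_{2,2}(n) are the sums of
    'C(m_1, 2) and of m_1 m_2 over the binary partitions of n. A binary
    partition of n+1 either arises from one of n by adding a part 1 or, for n
    odd, from one of (n+1)/2 by doubling; the two sums and that of m_2
    therefore satisfy first-order recurrences, and the increment of b_{2,2} at
    m is the sum of m_2 over the binary partitions of m. *)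

(** * Multiplicities of 1 and 2 in [pre2] *)

Lemma pre2_rcons (s : seq nat) (x : nat) :
  perm_eq (pre2 (rcons s x)) (pre2 s ++ [seq y * x | y <- s]).
Proof.
rewrite /pre2 size_rcons perm_sort -addn1 iotaD allpairs_cat /=.
rewrite cats0 add0n perm_cat //.
  rewrite perm_sym perm_sort.
  apply/permP => a; congr (count a _); apply/eq_in_allpairs_dep => k.
  rewrite mem_iota /= => lt_ks i; rewrite mem_iota /= => lt_ik.
  by rewrite !nth_rcons lt_ks (ltn_trans lt_ik lt_ks).
apply/permP => a; congr (count a _).
rewrite nth_rcons ltnn eqxx -[in RHS](mkseq_nth 0 s) /mkseq -map_comp.
apply/eq_in_map => i; rewrite mem_iota /= => lt_is.
by rewrite nth_rcons lt_is.
Qed.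

Lemma count1_pre2 (s : seq nat) : count_mem 1 (pre2 s) = 'C(count_mem 1 s, 2).
Proof.
elim/last_ind: s => [//|s x IHs].
rewrite (permP (pre2_rcons s x)) count_cat IHs count_map -cats1 count_cat /=.
have [->|x_neq1] := eqVneq x 1.
  by rewrite !addn0 addn1 binS bin1; congr addn; apply: eq_count => y /=; lia.
rewrite !addn0 [X in _ + X = _](@eq_count _ _ pred0) ?count_pred0 ?addn0 // => y /=.
by rewrite muln_eq1 (negbTE x_neq1) andbF.
Qed.

Lemma count2_pre2 (s : seq nat) :
  count_mem 2 (pre2 s) = count_mem 1 s * count_mem 2 s.
Proof.
elim/last_ind: s => [//|s x IHs].
rewrite (permP (pre2_rcons s x)) count_cat IHs count_map -cats1 !count_cat /=.
(* The cases are x = 0, 1, 2 and x >= 3. Only 1 and 2 create new products equal to 2: a new 1 pairs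
   with each earlier 2, and a new 2 with each earlier 1. *)
case: x => [|[|[|x]]]; rewrite !addn0 /= ?addn0.
- by rewrite [X in _ + X = _](@eq_count _ _ pred0) ?count_pred0 ?addn0 //
    => y /=; lia.
- by rewrite addn1 mulSn addnC; congr addn; apply: eq_count => y /=; lia.
- by rewrite addn1 mulnS addnC; congr addn; apply: eq_count => y /=; lia.
- by rewrite [X in _ + X = _](@eq_count _ _ pred0) ?count_pred0 ?addn0 //
    => -[|y] /=; lia.
Qed.

(** * Power sums and injectivity of [pre2] *)

Definition power_sum (j : nat) (s : seq nat) : nat := \sum_(x <- s) x ^ j.

Lemma power_sum_pre2 (j : nat) (s : seq nat) :
  power_sum j s ^ 2 = 2 * power_sum j (pre2 s) + power_sum (2 * j) s.
Proof.
rewrite /power_sum; elim/last_ind: s => [|s x IHs]; first by rewrite !big_nil.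
rewrite (perm_big _ (pre2_rcons s x)) /= -cats1 !big_cat /= !big_seq1 big_map.
rewrite sqrnD IHs -(eq_bigr _ (fun y _ => esym (expnMn y x j))).
rewrite -big_distrl /= (mulnC 2 j) expnM; lia.
Qed.

Lemma power_sum_pow2_eq (s t : seq nat) (k : nat) :
  sumn s = sumn t -> pre2 s = pre2 t ->
  power_sum (2 ^ k) s = power_sum (2 ^ k) t.
Proof.
move=> sum_st pre_st; elim: k => [|k IHk].
  by rewrite /power_sum -[LHS]sumnE -[RHS]sumnE.
have := power_sum_pre2 (2 ^ k) s; rewrite IHk power_sum_pre2 pre_st expnS.
by move/addnI.
Qed.

Lemma mul_exp_lt_expS (m y j : nat) :
  0 < j -> m * y <= j -> m * y ^ j < y.+1 ^ j.
Proof.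
case: y => [|y] j_gt0 le_my_j; first by rewrite exp0n // muln0 exp1n.
(* Bernoulli's inequality 1 + i/(y+1) <= (1 + 1/(y+1))^i, cleared of denominators. *)
have bernoulli i : y.+1 ^ i * (y.+1 + i) <= y.+1 * y.+2 ^ i.
  elim: i => [|i IHi]; first by rewrite !expn0 mul1n muln1 addn0.
  rewrite !expnS.
  apply: (@leq_trans (y.+2 * (y.+1 ^ i * (y.+1 + i)))); last first.
    by rewrite [leqRHS]mulnCA leq_mul2l IHi orbT.
  by rewrite -mulnA mulnCA [leqRHS]mulnCA leq_mul2l; apply/orP; right; lia.
rewrite -(ltn_pmul2l (ltn0Sn y)); apply: leq_trans (bernoulli j).
have y_gt0 : 0 < y.+1 ^ j by rewrite expn_gt0.
nia.
Qed.

Lemma power_sum_lt (x : nat) (t : seq nat) :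
  0 < x -> all (fun y => y < x) t -> exists k, power_sum (2 ^ k) t < x ^ (2 ^ k).
Proof.
(* With x now the predecessor of the bound, the power sum is at most [size t * x ^ j] for j = 2^k.
   Since 2^k >= k, this k gives [size t * x <= j], as [mul_exp_lt_expS] requires. *)
case: x => // x _ lt_tx; exists (size t * x).
have pow_gt0 : 0 < 2 ^ (size t * x) by rewrite expn_gt0.
have le_pow := ltnW (ltn_expl (size t * x) (ltnSn 1)).
apply: leq_ltn_trans (mul_exp_lt_expS pow_gt0 le_pow).
move: (2 ^ _) pow_gt0 => j j_gt0 {le_pow}.
elim: t lt_tx => [_|y t IHt /= /andP[le_yx /IHt le_t]].
  by rewrite /power_sum big_nil.
by rewrite /power_sum big_cons mulSn leq_add // leq_exp2r.
Qed.

(** If y < x, then all entries of [y :: t] lie below x, so for some k its power sum drops below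
    x^(2^k), which is a single term of the power sum of [x :: s]. *)
Lemma leq_head_power_sum (x y : nat) (s t : seq nat) :
    path geq y t ->
    (forall k, power_sum (2 ^ k) (x :: s) = power_sum (2 ^ k) (y :: t)) ->
  x <= y.
Proof.
move=> sorted_t eq_st; rewrite leqNgt; apply/negP => lt_yx.
have [|k] := @power_sum_lt x (y :: t) (leq_ltn_trans (leq0n y) lt_yx).
  rewrite /= lt_yx; apply: sub_all (order_path_min _ sorted_t).
    by move=> z /= le_zy; apply: leq_ltn_trans lt_yx.
  by move=> a b c /= le_ab le_ca; apply: leq_trans le_ab.
by rewrite -eq_st /power_sum big_cons ltnNge leq_addr.
Qed.

Lemma eq_power_sum_pow2 (s t : seq nat) :
    sorted geq s -> sorted geq t -> 0 \notin s -> 0 \notin t ->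
    (forall k, power_sum (2 ^ k) s = power_sum (2 ^ k) t) ->
  s = t.
Proof.
(* The exponent 2^0 = 1 rules out that one list ends before the other. *)
have pos x u : 0 \notin x :: u -> 0 < power_sum (2 ^ 0) (x :: u).
  by rewrite inE /power_sum big_cons negb_or expn1; lia.
elim: s t => [|x s IHs] [|y t] //=.
- by move=> _ _ _ /pos + /(_ 0); rewrite /power_sum big_nil => /[swap] <-.
- by move=> _ _ /pos + _ /(_ 0); rewrite /power_sum big_nil => /[swap] ->.
move=> path_s path_t s0 t0 eq_st.
have eq_xy : x = y.
  apply/eqP; rewrite eqn_leq (leq_head_power_sum path_t eq_st).
  by rewrite (@leq_head_power_sum y x t s) // => k; rewrite eq_st.
move: s0 t0; rewrite !inE !negb_or => /andP[_ s0] /andP[_ t0].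
congr (_ :: _) => //; apply: IHs s0 t0 _.
- exact: path_sorted path_s.
- exact: path_sorted path_t.
move=> k; move: (eq_st k); rewrite /power_sum !big_cons eq_xy.
exact: addnI.
Qed.

Lemma pre2_inj (n : nat) : set_inj (partitions n) pre2.
Proof.
move=> s t; rewrite !inE => -[sorted_s s_gt0 sum_s] [sorted_t t_gt0 sum_t] eq_st.
apply: eq_power_sum_pow2 => //.
- by apply/negP => /s_gt0.
- by apply/negP => /t_gt0.
by move=> k; apply: power_sum_pow2_eq => //; rewrite sum_s.
Qed.

(** * Appending a part 1 and doubling all parts *)

Lemma sorted_geq_rcons1 (s : seq nat) :
  (forall x, x \in s -> 0 < x) -> sorted geq (rcons s 1) = sorted geq s.
Proof.
have geq_trans : transitive geq by move=> y x z /= le_yx /leq_trans; apply.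
move=> s_gt0; rewrite !sorted_pairwise // pairwise_rcons.
by rewrite (_ : all _ _ = true) //; apply/allP.
Qed.

Lemma sorted_geq_double (s : seq nat) :
  sorted geq [seq x.*2 | x <- s] = sorted geq s.
Proof. by rewrite sorted_map; apply: eq_sorted => x y /=; rewrite leq_double. Qed.

Lemma sumn_double (s : seq nat) : sumn [seq x.*2 | x <- s] = (sumn s).*2.
Proof. by elim: s => //= x s ->; rewrite doubleD. Qed.

Lemma binary_partitions_rcons1 (n : nat) (s : seq nat) :
  binary_partitions n.+1 (rcons s 1) <-> binary_partitions n s.
Proof.
split=> [] [[sorted_s s_gt0 sum_s] s_pow2]; split.
- have {}s_gt0 x : x \in s -> 0 < x.
    by move=> xs; apply: s_gt0; rewrite mem_rcons inE xs orbT.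
  split=> //; first by rewrite -sorted_geq_rcons1.
  by apply: succn_inj; rewrite -sum_s sumn_rcons addn1.
- by move=> x xs; apply: s_pow2; rewrite mem_rcons inE xs orbT.
- split; first by rewrite sorted_geq_rcons1.
    by move=> x; rewrite mem_rcons inE => /predU1P[->|/s_gt0].
  by rewrite sumn_rcons sum_s addn1.
- move=> x; rewrite mem_rcons inE => /predU1P[->|/s_pow2 //].
  by exists 0.
Qed.

Lemma binary_partitions_double (n : nat) (s : seq nat) :
  binary_partitions n.*2 [seq x.*2 | x <- s] <-> binary_partitions n s.
Proof.
split=> [] [[sorted_s s_gt0 sum_s] s_pow2]; split.
- split; first by rewrite -sorted_geq_double.
    by move=> x /(map_f double) /s_gt0; rewrite double_gt0.
  by apply: double_inj; rewrite -sum_s sumn_double.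
- move=> x xs; have [[|k] def_x] := s_pow2 _ (map_f double xs).
    by move: (congr1 odd def_x); rewrite odd_double.
  by exists k; apply: double_inj; rewrite def_x expnS mul2n.
- split; first by rewrite sorted_geq_double.
    by move=> _ /mapP[x /s_gt0 x_gt0 ->]; rewrite double_gt0.
  by rewrite sumn_double sum_s.
- by move=> _ /mapP[x /s_pow2[k ->] ->]; exists k.+1; rewrite expnS mul2n.
Qed.

(** A part 1 is minimal, hence can be found at the end of the sorted list; without it, every part is
    a power 2^k with k > 0 and can be halved. *)
Lemma binary_partitions_cases (n : nat) (s : seq nat) :
  binary_partitions n s ->
  (exists t, s = rcons t 1) \/ (exists t, s = [seq x.*2 | x <- t]).
Proof.
move=> [[sorted_s s_gt0 _] s_pow2]; have [s1|s1] := boolP (1 \in s).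
  left; case/lastP: s => // s y in sorted_s s_gt0 s1 {s_pow2} *; exists s.
  congr rcons; apply/eqP; rewrite eqn_leq s_gt0 ?mem_rcons ?mem_head // andbT.
  move: sorted_s; rewrite sorted_pairwise; last first.
    by move=> b a c /= le_ba /leq_trans; apply.
  rewrite pairwise_rcons => /andP[/allP le_y _].
  by move: s1; rewrite mem_rcons inE => /predU1P[->|/le_y].
right; exists [seq x./2 | x <- s]; rewrite -map_comp -[LHS]map_id.
apply/eq_in_map => x xs /=; have [[|k] def_x] := s_pow2 _ xs.
  by have x1 : x = 1 := def_x; rewrite -x1 xs in s1.
by rewrite def_x expnS mul2n doubleK.
Qed.

(** * Sums over binary partitions *)

Lemma finite_binary_partitions (n : nat) : finite_set (binary_partitions n).
Proof. by apply: sub_finite_set (finite_partitions n) => s []. Qed.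

Definition binary_sum (F : seq nat -> nat) (n : nat) : nat :=
  (\sum_(s \in binary_partitions n) F s)%R.

(** Injectivity of [pre2] enters here: no two binary partitions of n merge in the image. *)
Lemma b2E (i n : nat) : b2 i n = binary_sum (fun s => count_mem i (pre2 s)) n.
Proof.
apply: fsbig_image => s t; rewrite !inE => -[s_n _] [t_n _].
by apply: (@pre2_inj n); rewrite inE.
Qed.

Lemma eq_binary_sum (F G : seq nat -> nat) (n : nat) :
  (forall s, binary_partitions n s -> F s = G s) -> binary_sum F n = binary_sum G n.
Proof. by move=> eqFG; apply: eq_fsbigr => s /set_mem/eqFG. Qed.

Lemma binary_sumD (F G : seq nat -> nat) (n : nat) :
  binary_sum (fun s => F s + G s) n = binary_sum F n + binary_sum G n.
Proof. exact/fsbig_split/finite_binary_partitions. Qed.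

Lemma binary_sum0 (n : nat) : binary_sum (fun=> 0) n = 0.
Proof. exact: fsbig1. Qed.

Lemma binary_sumS (F : seq nat -> nat) (n : nat) :
  binary_sum F n.+1 = binary_sum (fun s => F (rcons s 1)) n +
    (if odd n then binary_sum (fun s => F [seq x.*2 | x <- s]) (n.+1)./2 else 0).
Proof.
pose D := (if odd n then map double @` binary_partitions (n.+1)./2 else set0)%classic.
have -> : (if odd n then binary_sum (fun s => F [seq x.*2 | x <- s]) (n.+1)./2
           else 0) = (\sum_(s \in D) F s)%R.
  rewrite /D; case: ifP => _; last by rewrite fsbig_set0.
  apply/esym/fsbig_image => s t _ _; exact/inj_map/double_inj.
have -> : binary_sum (fun s => F (rcons s 1)) n =
          (\sum_(s \in (rcons^~ 1 @` binary_partitions n)%classic) F s)%R.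
  by apply/esym/fsbig_image => s t _ _ /rcons_inj[].
have finite_D : finite_set D.
  by rewrite /D; case: ifP => // _; apply/finite_image/finite_binary_partitions.
rewrite -[RHS]/(GRing.add _ _) -fsbigU0 //; first last.
(* The two families are disjoint: the last entry is 1 in one and even in the other, the default 0
   covering the empty list. *)
- move=> _ [[s _ <-]]; rewrite /D; case: ifP => // _ [t _ /(congr1 (last 0))].
  rewrite last_rcons => /eqP.
  by case/lastP: t => [|t x] //; rewrite map_rcons last_rcons => /eqP; lia.
- exact/finite_image/finite_binary_partitions.
apply: eq_fsbigl; apply/seteqP; split=> s.
  move=> s_n; have [[t def_s]|[t def_s]] := binary_partitions_cases s_n; last right.
    by left; exists t => //; apply/binary_partitions_rcons1; rewrite -def_s.
  have [[_ _ sum_s] _] := s_n; rewrite def_s sumn_double in sum_s.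
  have odd_n : odd n by rewrite -[n]/(n.+1.-1) -sum_s; lia.
  rewrite /D odd_n; exists t => //; apply/binary_partitions_double.
  by rewrite -def_s -sum_s doubleK sum_s.
move=> [[t t_n <-]|]; first exact/binary_partitions_rcons1.
rewrite /D; case: ifP => // odd_n [t t_n <-].
by move/binary_partitions_double: t_n; rewrite (_ : _.*2 = n.+1) //; lia.
Qed.

(** * Recurrences for the sums of multiplicities *)

Lemma count_mem_rcons (i x : nat) (s : seq nat) :
  count_mem i (rcons s x) = count_mem i s + (x == i).
Proof. by rewrite -cats1 count_cat /= addn0. Qed.

Lemma count_mem_double (i : nat) (s : seq nat) :
  count_mem i.*2 [seq x.*2 | x <- s] = count_mem i s.
Proof. by rewrite count_map; apply: eq_count => x /=; lia. Qed.

Lemma count1_double (s : seq nat) : count_mem 1 [seq x.*2 | x <- s] = 0.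
Proof. by apply/count_memPn/mapP => -[x _]; lia. Qed.

(** Doubled partitions have no part 1 and contribute nothing; an appended 1 turns m_1 m_2 into (m_1
    + 1) m_2. *)
Lemma b2_2S (n : nat) : b2 2 n.+1 = b2 2 n + binary_sum (count_mem 2) n.
Proof.
rewrite !b2E binary_sumS -binary_sumD.
rewrite [X in _ + X](_ : _ = 0) ?addn0; last first.
  case: ifP => // _; rewrite -[RHS](binary_sum0 (n.+1)./2).
  by apply: eq_binary_sum => s _; rewrite count2_pre2 count1_double.
apply: eq_binary_sum => s _; rewrite !count2_pre2 !count_mem_rcons /=; lia.
Qed.

Lemma b2_1S (n : nat) : b2 1 n.+1 = b2 1 n + binary_sum (count_mem 1) n.
Proof.
rewrite !b2E binary_sumS -binary_sumD.
rewrite [X in _ + X](_ : _ = 0) ?addn0; last first.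
  case: ifP => // _; rewrite -[RHS](binary_sum0 (n.+1)./2).
  by apply: eq_binary_sum => s _; rewrite count1_pre2 count1_double.
apply: eq_binary_sum => s _.
by rewrite !count1_pre2 count_mem_rcons addn1 binS bin1.
Qed.

(** An appended 1 leaves m_2 unchanged, and doubling turns the parts 1 into the parts 2. *)
Lemma sum_count2S (n : nat) :
  binary_sum (count_mem 2) n.+1 = binary_sum (count_mem 2) n +
    (if odd n then binary_sum (count_mem 1) (n.+1)./2 else 0).
Proof.
rewrite binary_sumS; congr (_ + _).
  by apply: eq_binary_sum => s _; rewrite count_mem_rcons addn0.
by case: ifP => // _; apply: eq_binary_sum => s _; rewrite (count_mem_double 1).
Qed.

Lemma binary_partitions0 (s : seq nat) : binary_partitions 0 s -> s = [::].
Proof.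
by case: s => //= x s [[_ /(_ x (mem_head _ _)) x_gt0 /=]]; lia.
Qed.

(** Both sides vanish at n = 0 and grow by the sum of m_1 over the binary partitions of n+1 when n
    increases by 1: on the left only the step from 2n+1 to 2n+2 contributes. *)
Lemma sum_count2_even (n : nat) : binary_sum (count_mem 2) (2 * n) = b2 1 n.+1.
Proof.
have sum0 F : F [::] = 0 -> binary_sum F 0 = 0.
  move=> F0; rewrite -[RHS](binary_sum0 0).
  by apply: eq_binary_sum => s /binary_partitions0 ->.
elim: n => [|n IHn]; first by rewrite b2_1S b2E !sum0.
rewrite b2_1S -IHn !mul2n doubleS !sum_count2S /= odd_double addn0 /=.
by rewrite doubleK.
Qed.

Theorem theorem12 (n : nat) :
  Delta (b2 2) (2 * n + 1) = Delta (b2 2) (2 * n) /\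
  Delta (b2 2) (2 * n) = Posz (b2 1 (n + 1)).
Proof.
have Delta_b2 m : Delta (b2 2) m = Posz (binary_sum (count_mem 2) m).
  by rewrite /Delta b2_2S PoszD GRing.addrC GRing.addKr.
(* As 2n is even, the sum of m_2 does not change from 2n to 2n+1. *)
rewrite !Delta_b2 !addn1 sum_count2S mul2n odd_double addn0 -mul2n.
by rewrite sum_count2_even.
Qed.
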